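(* Let $(X_n)_{n\ge1}$ be a sequence of nonnegative positively associated random variables and let $S_n=\sum_{i=1}^nX_i$. Let $g:[0,\infty)\to\mathbb{R}$ be convex and strictly increasing with $g(0)=0$, such that $E|g(X_n)|<\infty$ for all $n\ge1$. Let $\tau$ be a bounded stopping time and assume that $I\{\tau\le j\}$ is a componentwise nonincreasing function of $S_1,\ldots,S_j$ for every $j\ge1$. Then $$E(g(S_\tau))\ge E\left(\sum_{i=1}^{\tau}E(g(X_i))\right).$$
   Context: Functions are understood to be Borel measurable; $I\{A\}$ is the indicator of $A$. A finite collection $X_1,\ldots,X_n$ of random variables is (positively) associated if $\operatorname{Cov}(f(X_1,\ldots,X_n),h(X_1,\ldots,X_n))\ge0$ for all componentwise nondecreasing functions $f,h$ on $\mathbb{R}^n$ for which the covariance is defined; an infinite collection is associated if every finite subcollection is. A stopping time is a random variable $\tau$ with values in $\{1,2,\ldots\}\cup\{\infty\}$ with $\{\tau\le j\}\in\sigma(S_1,\ldots,S_j)$ for every $j\ge1$; it is bounded if $\tau\le M$ a.s. for some $M\in\mathbb{N}$. ''$I\{\tau\le j\}$ is a componentwise nonincreasing function of $S_1,\ldots,S_j$'' means $I\{\tau\le j\}=h_j(S_1,\ldots,S_j)$ for some componentwise nonincreasing function $h_j$ on $\mathbb{R}^j$. For a deterministic sequence $(a_i)_{i\ge1}$, $\sum_{i=1}^{\tau}a_i:=\sum_{i=1}^{\infty}a_iI\{\tau\ge i\}$; thus if $\tau\le M$ a.s., $E(\sum_{i=1}^\tau a_i)=\sum_{i=1}^M a_iP(\tau\ge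 i)$. Here $a_i=E(g(X_i))$. Since $g\ge0$, $E(g(S_\tau))$ is understood as an element of $[0,\infty]$. *)

(* Defs.v *)
From HB Require Import structures.
From mathcomp Require Import all_boot all_order all_algebra.
From mathcomp Require Import all_classical all_reals all_analysis.

Set Implicit Arguments.
Unset Strict Implicit.
Unset Printing Implicit Defensive.

Import Order.TTheory GRing.Theory Num.Theory.
Import numFieldNormedType.Exports.

Local Open Scope classical_set_scope.
Local Open Scope ring_scope.

(* Vectors of R^n are [n.-tuple R]; the library's sigma-algebra on
   [n.-tuple R] is generated by the coordinates, i.e. it is the Borel one. *)

Definition cw_nondecreasing (R : realType) (n : nat) (f : n.-tuple R -> R) :=
  forall x y : n.-tuple R,
    (forall i, tnth x i <= tnth y i) -> f x <= f y.

Definition cw_nonincreasing (R : realType) (n : nat) (f : n.-tuple R -> R) :=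
  forall x y : n.-tuple R,
    (forall i, tnth x i <= tnth y i) -> f y <= f x.

Definition vec (T : Type) (R : realType) (n : nat) (Y : 'I_n -> T -> R)
  (w : T) : n.-tuple R := [tuple Y i w | i < n].

Definition covariance_defined d (T : measurableType d) (R : realType)
    (P : probability T R) (U V : T -> R) :=
  [/\ P.-integrable setT (EFin \o U),
      P.-integrable setT (EFin \o V) &
      P.-integrable setT (EFin \o (U \* V))].

Definition associated_fin d (T : measurableType d) (R : realType)
    (P : probability T R) (n : nat) (Y : 'I_n -> T -> R) :=
  forall f h : n.-tuple R -> R,
    measurable_fun setT f -> measurable_fun setT h ->
    cw_nondecreasing f -> cw_nondecreasing h ->
    covariance_defined P (f \o vec Y) (h \o vec Y) ->
    (0 <= covariance P (f \o vec Y) (h \o vec Y))%E.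

(* The subfamily (Y_i)_{i in D} is associated: every finite subcollection,
   listed without repetition by [s], is associated. *)
Definition associated_on d (T : measurableType d) (R : realType)
    (P : probability T R) (I : Type) (D : set I) (Y : I -> T -> R) :=
  forall (n : nat) (s : 'I_n -> I), injective s -> (forall k, D (s k)) ->
    associated_fin P (fun k => Y (s k)).

Definition partial_sum (T : Type) (R : realType) (X : nat -> T -> R)
  (n : nat) (w : T) : R := \sum_(1 <= i < n.+1) X i w.

(* A time is an [option nat], with [None] standing for the value +oo. *)
Definition time_le (t : option nat) (j : nat) : bool :=
  if t is Some k then (k <= j)%N else false.

Definition time_ge (t : option nat) (j : nat) : bool :=
  if t is Some k then (j <= k)%N else true.

(* [{tau <= j}] is in sigma(S_1, ..., S_j) for all j >= 1, and tau >= 1. *)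
Definition stopping_time (T : Type) (R : realType) (S : nat -> T -> R)
    (tau : T -> option nat) :=
  (forall w, time_ge (tau w) 1) /\
  (forall j : nat, (1 <= j)%N ->
    g_sigma_preimage (fun i : 'I_j => S i.+1) [set w | time_le (tau w) j]).

Definition bounded_time d (T : measurableType d) (R : realType)
    (P : probability T R) (tau : T -> option nat) :=
  exists M : nat, {ae P, forall w, time_le (tau w) M}.

(* The value 0 on [{tau = +oo}] is a convention; it plays no role when tau is
   almost surely finite. *)
Definition stopped (T : Type) (R : realType) (S : nat -> T -> R)
    (tau : T -> option nat) (w : T) : R :=
  if tau w is Some k then S k w else 0.

Definition stopped_sum (T : Type) (R : realType) (a : nat -> \bar R)
    (tau : T -> option nat) (w : T) : \bar R :=
  (\sum_(1 <= i <oo) a i * (\1_[set v | time_ge (tau v) i] w)%:E)%E.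

(* Main.v *)
Require Import Defs.
From HB Require Import structures.
From mathcomp Require Import all_boot all_order all_algebra.
From mathcomp Require Import all_classical all_reals all_analysis.
From mathcomp Require Import measurable_realfun.

(** Since [g] is convex on the half-line and [g 0 = 0], it is superadditive
there, so that on [{tau <= M}]
[[
  g (S_tau) >= \sum_(1 <= i <= tau) g (X_i)
             = \sum_(1 <= i <= M) g (X_i) * 1_{tau >= i}.
]]
Taking expectations, it remains to bound each term from below by
[E (g (X_i)) * P (tau >= i)] ([expectation_before_stopping]).  This is where
association enters: [g (X_i)] is a nondecreasing function of [X_i], while
[1_{tau >= i} = 1 - 1_{tau <= i - 1}] is a nondecreasing function of
[S_1, ..., S_(i-1)], hence of [X_1, ..., X_(i-1)]; their covariance is therefore
nonnegative.  Summing over [i <= M] gives the expectation of the stopped sum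
([integral_stopped_sum]), because [tau >= i] has probability zero for [i > M].

Association quantifies over functions that are monotone on the whole space,
whereas [g] is controlled only on the half-line; [g] is replaced throughout by
[x |-> g (max 0 x)], which is nondecreasing, hence Borel, and agrees with [g]
on nonnegative reals. *)

Set Implicit Arguments.
Unset Strict Implicit.

Import Order.TTheory GRing.Theory Num.Theory.
Import numFieldNormedType.Exports.

Local Open Scope classical_set_scope.
Local Open Scope ring_scope.

(** * Convex functions on the half-line *)

Section real_function.
Context {R : realType}.
Implicit Types g : R -> R.

Lemma convex_superadditive g :
  convex_function (`[0, +oo[%classic : set R) g -> g 0 = 0 ->
  forall x y, 0 <= x -> 0 <= y -> g x + g y <= g (x + y).
Proof.
move=> cg g0 x y x0 y0.
have [/eqP|xyN0] := eqVneq (x + y) 0.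
  by rewrite paddr_eq0// => /andP[/eqP-> /eqP->]; rewrite !addr0 g0.
have xy0 : 0 < x + y by rewrite lt0r xyN0 addr_ge0.
(* [z] lies on the chord from [0] to [x + y], and [g] vanishes at [0]. *)
have scale z : 0 <= z -> z <= x + y -> g z <= z / (x + y) * g (x + y).
  move=> z0 zxy.
  have t0 : 0 <= z / (x + y) by rewrite divr_ge0// ltW.
  have t1 : z / (x + y) <= 1 by rewrite ler_pdivrMr// mul1r.
  have zE : conv (Itv01 t0 t1) (x + y : R^o) (0 : R^o) = z.
    by rewrite convRE/= mulr0 addr0 divfK.
  rewrite -[in leLHS]zE; apply: le_trans (cg _ _ _ _ _) _.
  - by rewrite inE/= in_itv/= andbT ltW.
  - by rewrite inE/= in_itv/= lexx.
  - by rewrite convRE/= g0 mulr0 addr0.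
have -> : g (x + y) = x / (x + y) * g (x + y) + y / (x + y) * g (x + y).
  by rewrite -!mulrDl divff// mul1r.
by apply: lerD; apply: scale; rewrite ?lerDl ?lerDr.
Qed.

Lemma superadditive_sum g : g 0 = 0 ->
  (forall x y, 0 <= x -> 0 <= y -> g x + g y <= g (x + y)) ->
  forall (u : nat -> R) (s : seq nat),
    (forall i, i \in s -> 0 <= u i) ->
    \sum_(i <- s) g (u i) <= g (\sum_(i <- s) u i).
Proof.
move=> g0 gD u; elim=> [_|i s IH u0]; first by rewrite !big_nil g0.
rewrite !big_cons (le_trans (lerD (lexx _) (IH _)))//.
  by move=> j js; apply: u0; rewrite inE js orbT.
apply: gD; first by rewrite u0// mem_head.
by rewrite big_seq sumr_ge0// => j js; rewrite u0// inE js orbT.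
Qed.

Lemma nondecreasing_max0 g :
  {in `[0, +oo[ &, forall x y : R, x < y -> g x < g y} ->
  {homo (fun x => g (Num.max 0 x)) : x y / x <= y}.
Proof.
move=> gi x y xy /=.
have: Num.max 0 x <= Num.max 0 y by rewrite ge_max le_max lexx/= le_max xy orbT.
rewrite le_eqVlt => /predU1P[->//|/gi/ltW]; apply.
  by rewrite in_itv/= andbT le_max lexx.
by rewrite in_itv/= andbT le_max lexx.
Qed.

End real_function.

(** * Measurability of stopped processes *)

(** Evaluating a countable family of measurable functions at a random index
that takes each value on a measurable set gives a measurable function. *)
Lemma measurable_fun_countable_cases d d' (T : measurableType d)
    (U : measurableType d') (I : countType) (tau : T -> I) (F : I -> T -> U) :
  (forall i, measurable [set w | tau w = i]) ->
  (forall i, measurable_fun setT (F i)) ->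
  measurable_fun setT (fun w => F (tau w) w).
Proof.
move=> mtau mF _ B mB; rewrite setTI.
rewrite (_ : _ @^-1` _ =
    \bigcup_i ([set w | tau w = i] `&` (F i @^-1` B))); last first.
  apply/seteqP; split => [w /= Bw|w [i _ [/= <-//]]].
  by exists (tau w).
apply: countable_bigcupT_measurable => // i; apply: measurableI => //.
by rewrite -[X in measurable X]setTI; exact: mF.
Qed.

Section stopping.
Context d (T : measurableType d) (R : realType) (P : probability T R).
Variable tau : T -> option nat.

(** The hypothesis [tau >= 1] settles the case [j = 0]. *)
Lemma measurable_time_eq :
  (forall j, (1 <= j)%N -> measurable [set w | time_le (tau w) j]) ->
  (forall w, time_ge (tau w) 1) ->
  forall o, measurable [set w | tau w = o].
Proof.
move=> mle ge1.
have mleT j : measurable [set w | time_le (tau w) j].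
  case: j => [|j]; last exact: mle.
  rewrite (_ : [set _ | _] = set0)//; apply/seteqP; split => w //=.
  by have := ge1 w; case: (tau w) => [[]|].
case=> [k|].
  rewrite (_ : [set _ | _] = [set w | time_le (tau w) k] `\`
    (if k is j.+1 then [set w | time_le (tau w) j] else set0)); last first.
    apply/seteqP; split => w /=.
      by case: k => [|k] /= ->; split; rewrite /= ?leqnn ?ltnn.
    case: k => [|k] /=; case: (tau w) => [i|] //= [] //.
      by rewrite leqn0 => /eqP->.
    move=> ik ki; congr Some; apply/eqP.
    by rewrite eqn_leq ik/= ltnNge; apply/negP.
  by apply: measurableD => //; case: k.
rewrite (_ : [set _ | _] = ~` \bigcup_j [set w | time_le (tau w) j]); last first.
  apply/seteqP; split => w /=; first by move=> tauw [j _] /=; rewrite tauw.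
  case tauw: (tau w) => [i|]// H; exfalso; apply: H.
  by exists i; rewrite //= tauw /=.
by apply: measurableC; exact: bigcupT_measurable.
Qed.

Lemma measurable_time_ge :
  (forall o, measurable [set w | tau w = o]) ->
  forall i, measurable [set w | time_ge (tau w) i].
Proof.
move=> meq i.
rewrite (_ : [set _ | _] =
    \bigcup_(o in [set o | time_ge o i]) [set w | tau w = o]); last first.
  by apply/seteqP; split => [w /= h|w [t /= ti ->]]; [exists (tau w)|].
rewrite bigcup_mkcond; apply: countable_bigcupT_measurable => // o.
by case: ifP.
Qed.

(** Wald-type formula for a deterministic nonnegative sequence and a time that
is almost surely at most [M]: all terms beyond [M] vanish almost surely. *)
Lemma integral_stopped_sum (a : nat -> \bar R) (M : nat) :
  (forall o, measurable [set w | tau w = o]) ->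
  {ae P, forall w, time_le (tau w) M} ->
  (forall i, (1 <= i)%N -> (0 <= a i)%E) ->
  (\int[P]_w stopped_sum a tau w =
   \sum_(1 <= i < M.+1) a i * P [set w | time_ge (tau w) i])%E.
Proof.
move=> meq tauM a0; have mge := measurable_time_ge meq.
pose t i w : \bar R := (a i * (\1_[set v | time_ge (tau v) i] w)%:E)%E.
have t0 i w : (1 <= i)%N -> (0 <= t i w)%E.
  by move=> i1; apply: mule_ge0; rewrite ?a0// lee_fin.
have mt i : measurable_fun setT (t i).
  apply: measurable_funeM; apply/measurable_EFinP; exact: measurable_indic.
have -> : (\sum_(1 <= i < M.+1) a i * P [set w | time_ge (tau w) i] =
    \int[P]_w \sum_(1 <= i < M.+1) t i w)%E.
  under eq_integral do rewrite big_add1.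
  rewrite big_add1/= ge0_integral_sum// => [|i w _]; last exact: t0.
  apply: eq_bigr => i _; rewrite ge0_integralZl//; last 2 first.
  - by apply/measurable_EFinP; exact: measurable_indic.
  - exact: a0.
  by rewrite integral_indic// setIT.
apply: ge0_ae_eq_integral => //.
- rewrite (_ : stopped_sum a tau = fun w =>
      (\sum_(0 <= i <oo | i \in leq 1) t i w)%E); last first.
    by apply/funext => w; rewrite /stopped_sum ereal_series.
  by apply: ge0_emeasurable_sum => // k w _; exact: t0.
- exact: emeasurable_sum.
- by move=> w _; apply: nneseries_ge0 => i i1 _; exact: t0.
- by move=> w _; rewrite big_nat_cond sume_ge0// => i /andP[/andP[i1 _] _]; exact: t0.
apply: filterS tauM => w wM _.
rewrite /stopped_sum (nneseries_split 1 M); last by move=> k; exact: t0.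
rewrite add1n [X in (_ + X)%E]eseries0 ?adde0//.
move=> i Mi _; rewrite indicE memNset ?mule0//=.
move: wM; case: (tau w) => //= k kM; apply/negP; rewrite -ltnNge.
exact: leq_ltn_trans Mi.
Qed.

End stopping.

(** * Association *)

Section associated_expectation.
Context d (T : measurableType d) (R : realType) (P : probability T R).

(** Nonnegativity of the covariance, written as an inequality between
expectations. *)
Lemma associated_expectationM (n : nat) (Y : 'I_n -> T -> R)
    (f h : n.-tuple R -> R) :
  associated_fin P Y ->
  measurable_fun setT f -> measurable_fun setT h ->
  cw_nondecreasing f -> cw_nondecreasing h ->
  covariance_defined P (f \o vec Y) (h \o vec Y) ->
  ('E_P[f \o vec Y] * 'E_P[h \o vec Y]
    <= 'E_P[(f \o vec Y) \* (h \o vec Y)])%E.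
Proof.
move=> aY mf mh ndf ndh cov; have := aY _ _ mf mh ndf ndh cov.
case: cov => /Lfun1_integrable fL /Lfun1_integrable hL /Lfun1_integrable fhL.
rewrite covarianceE// sube_ge0// fin_numM//; exact: expectation_fin_num.
Qed.

End associated_expectation.

(** The first [m] partial sums [x_0 + ... + x_k], [k < m], of a vector [x] of
length [n].  The sum runs over the [l < n] with [l <= k], so that the definition
needs no relation between [m] and [n]. *)
Definition tuple_partial_sums (R : realType) (n m : nat) (x : n.-tuple R) :
  m.-tuple R := [tuple \sum_(l < n | (l <= k)%N) tnth x l | k < m].

Lemma tuple_partial_sums_vec (T : Type) (R : realType) (X : nat -> T -> R)
    (n m : nat) (w : T) : (m <= n)%N ->
  tuple_partial_sums m (vec (fun k : 'I_n => X k.+1) w) =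
  vec (fun k : 'I_m => partial_sum X k.+1) w.
Proof.
move=> mn; apply: eq_from_tnth => k; rewrite !tnth_mktuple.
rewrite /partial_sum big_add1 big_mkord/=.
rewrite (big_ord_widen n (fun l => X l.+1 w)) ?(leq_trans (ltn_ord k))//.
by apply: eq_bigr => l _; rewrite tnth_mktuple.
Qed.

Lemma measurable_tuple_partial_sums (R : realType) (n m : nat) :
  measurable_fun setT (@tuple_partial_sums R n m).
Proof.
apply/measurable_fun_tnthP => k.
rewrite (_ : _ \o _ = fun x : n.-tuple R =>
    \sum_(l < n) (if (l <= k)%N then tnth x l else 0)); last first.
  by apply/funext => x /=; rewrite tnth_mktuple big_mkcond.
apply: measurable_sum => l; case: (l <= k)%N => //.
exact: measurable_tnth.
Qed.

Lemma tuple_partial_sums_homo (R : realType) (n m : nat) (x y : n.-tuple R) :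
  (forall i, tnth x i <= tnth y i) ->
  forall k, tnth (tuple_partial_sums m x) k <= tnth (tuple_partial_sums m y) k.
Proof. by move=> xy k; rewrite !tnth_mktuple; apply: ler_sum. Qed.

Lemma time_geS (t : option nat) (j : nat) : time_ge t j.+1 = ~~ time_le t j.
Proof. by case: t => //= k; rewrite ltnNge. Qed.

Section association_and_stopping.
Context d (T : measurableType d) (R : realType) (P : probability T R).
Variables (X : nat -> {RV P >-> R}) (tau : T -> option nat).
Hypothesis X_assoc :
  associated_on P [set n : nat | (1 <= n)%N] (fun n => X n : T -> R).
Hypothesis tau_ge1 : forall w, time_ge (tau w) 1.
Hypothesis tau_mono : forall j : nat, (1 <= j)%N ->
  exists h : j.-tuple R -> R,
    [/\ measurable_fun setT h, cw_nonincreasing h &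
        forall w : T, \1_[set v | time_le (tau v) j] w =
          h (vec (fun i : 'I_j => partial_sum X i.+1) w)].

(** The event [tau >= i] and the nondecreasing function [f (X_i)] are
nonnegatively correlated. *)
Lemma expectation_before_stopping (i : nat) (f : R -> R) : (1 <= i)%N ->
  {homo f : x y / x <= y} ->
  P.-integrable setT (EFin \o (f \o X i)) ->
  measurable [set w | time_ge (tau w) i] ->
  ('E_P[f \o X i] * P [set w | time_ge (tau w) i]
   <= 'E_P[(f \o X i) \* \1_[set w | time_ge (tau w) i]])%E.
Proof.
(* For [i = 1] the event is the whole space. *)
case: i => // -[_ _ _ _|m _ f_homo fX_int mge].
  rewrite (_ : [set _ | _] = setT); last first.
    by apply/seteqP; split => // w _; exact: tau_ge1.
  rewrite probability_setT mule1 indicT.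
  rewrite [X in (_ <= 'E_P[X])%E](_ : _ = f \o X 1)//.
  by apply/funext => w /=; rewrite mulr1.
have [h [mh h_homo hE]] := tau_mono (ltn0Sn m).
(* [Y] lists [X_1, ..., X_(m+2)]; its last entry is [X_i] with [i = m + 2]. *)
pose Y (k : 'I_m.+2) : T -> R := X k.+1.
pose F (x : m.+2.-tuple R) := f (tnth x ord_max).
pose H (x : m.+2.-tuple R) := 1 - h (tuple_partial_sums m.+1 x).
have FE : F \o vec Y = f \o X m.+2.
  by apply/funext => w; rewrite /F /= tnth_mktuple.
have HE : H \o vec Y = \1_[set w | time_ge (tau w) m.+2].
  apply/funext => w; rewrite /H /=.
  rewrite (tuple_partial_sums_vec (fun k => X k : T -> R))// -hE !indicE.
  have -> : (w \in [set v | time_ge (tau v) m.+2]) =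
      ~~ (w \in [set v | time_le (tau v) m.+1]).
    by rewrite -in_setC; congr (w \in _); apply/seteqP; split=> v /=;
       rewrite time_geS => /negP.
  by case: (_ \in _); rewrite /= ?subrr ?subr0.
have aY : associated_fin P Y.
  by apply: (X_assoc (s := fun k : 'I_m.+2 => k.+1)) => // k l [] /val_inj.
have mF : measurable_fun setT F.
  apply: measurableT_comp; last exact: measurable_tnth.
  exact: nondecreasing_measurable.
have mH : measurable_fun setT H.
  apply: measurable_funB => //; apply: measurableT_comp => //.
  exact: measurable_tuple_partial_sums.
have ndF : cw_nondecreasing F by move=> x y xy; exact: f_homo.
have ndH : cw_nondecreasing H.
  move=> x y xy; rewrite /H lerD2l lerN2; apply: h_homo.
  exact: tuple_partial_sums_homo.
have := associated_expectationM aY mF mH ndF ndH.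
rewrite FE HE expectation_indic//; apply; split=> //.
- exact: integrable_indic.
- rewrite (_ : EFin \o _ = (EFin \o (f \o X m.+2)) \*
      (EFin \o \1_[set w | time_ge (tau w) m.+2]))%E; last first.
    by apply/funext => w /=; rewrite EFinM.
  apply: integrableMl => //.
  exists 1; split; rewrite ?num_real// => r r1 w _ /=; rewrite indicE.
  by rewrite ger0_norm// (le_trans _ (ltW r1))// lern1 leq_b1.
Qed.

End association_and_stopping.

(** * The lower bound for the stopped process *)

Unset Implicit Arguments.

(* X_n is [X n] for n >= 1; the random variable [X 0] is not used. *)
Theorem theorem4p6 (d : measure_display) (T : measurableType d)
    (R : realType) (P : probability T R)
    (X : nat -> {RV P >-> R})
    (X_ge0 : forall n : nat, (1 <= n)%N -> forall w : T, 0 <= X n w)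
    (X_assoc : associated_on P [set n : nat | (1 <= n)%N] (fun n => X n : T -> R))
    (g : R -> R)
    (g_convex : convex_function (`[0, +oo[%classic : set R) g)
    (g_incr : {in `[0, +oo[ &, forall x y : R, x < y -> g x < g y})
    (g0 : g 0 = 0)
    (gX_int : forall n : nat, (1 <= n)%N ->
       P.-integrable setT (EFin \o (g \o X n)))
    (tau : T -> option nat)
    (tau_stop : stopping_time (partial_sum X) tau)
    (tau_bounded : bounded_time P tau)
    (tau_mono : forall j : nat, (1 <= j)%N ->
       exists h : j.-tuple R -> R,
         [/\ measurable_fun setT h,
             cw_nonincreasing h &
             forall w : T, \1_[set v | time_le (tau v) j] w =
               h (vec (fun i : 'I_j => partial_sum X i.+1) w)]) :
  ('E_P[fun w => g (stopped (partial_sum X) tau w)]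
   >= \int[P]_w stopped_sum (fun i => 'E_P[g \o X i]) tau w)%E.
Proof.
pose f x := g (Num.max 0 x).
have f_homo : {homo f : x y / x <= y} by exact: nondecreasing_max0.
have fE x : 0 <= x -> f x = g x by rewrite /f => /max_idPr ->.
have f_ge0 x : 0 <= f x.
  have m0 : 0 <= Num.max 0 x by rewrite le_max lexx.
  by rewrite -[leLHS]g0 -(fE 0)// [leRHS]/f -(fE _ m0); exact: f_homo.
have fXE i : (1 <= i)%N -> f \o X i = g \o X i.
  by move=> i1; apply/funext => w /=; rewrite fE// X_ge0.
have [M tauM] := tau_bounded.
have ge1 := tau_stop.1.
have mle j : (1 <= j)%N -> measurable [set w | time_le (tau w) j].
  move=> /tau_mono[h [mh _ hE]]; apply/(measurable_indicP R).
  rewrite (_ : \1__ = h \o vec (fun k : 'I_j => partial_sum X k.+1)); last first.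
    by apply/funext => w; rewrite hE.
  apply: measurableT_comp => //; apply/measurable_fun_tnthP => k.
  rewrite (_ : _ \o _ = partial_sum X k.+1); last first.
    by apply/funext => w /=; rewrite tnth_mktuple.
  exact: measurable_sum.
have meq := measurable_time_eq mle ge1.
have mge := measurable_time_ge meq.
have S_ge0 n w : 0 <= partial_sum X n w.
  rewrite /partial_sum big_nat_cond sumr_ge0// => i /andP[/andP[i1 _] _].
  exact: X_ge0.
have mf : measurable_fun setT f by exact: nondecreasing_measurable.
pose Z w := \sum_(1 <= i < M.+1) f (X i w) * \1_[set v | time_ge (tau v) i] w.
have mZ i : measurable_fun setT
    (fun w => f (X i w) * \1_[set v | time_ge (tau v) i] w).
  apply: measurable_funM; first exact: measurableT_comp.
  exact: measurable_indic.
(* Terms with [tau < i <= M] vanish, and superadditivity bounds the others. *)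
have Z_le w : time_le (tau w) M -> Z w <= f (stopped (partial_sum X) tau w).
  rewrite /Z /stopped; case tauw : (tau w) => [k|]//= kM.
  rewrite fE//.
  have gD := convex_superadditive g_convex g0.
  apply: le_trans (superadditive_sum g0 gD _); last first.
    by move=> i; rewrite mem_index_iota => /andP[i1 _]; exact: X_ge0.
  rewrite (@big_cat_nat _ _ _ k.+1)//= [X in _ + X]big_nat_cond [X in _ + X]big1.
    rewrite addr0 [leLHS]big_nat_cond [leRHS]big_nat_cond.
    apply: ler_sum => i /andP[/andP[i1 ik] _].
    by rewrite fE ?X_ge0// indicE mem_set ?mulr1//= tauw.
  move=> i /andP[/andP[ki _] _]; rewrite indicE memNset ?mulr0//= tauw /=.
  by apply/negP; rewrite -ltnNge.
(* The convention that [stopped] is [0] when [tau] is infinite keeps it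
nonnegative, hence [f] and [g] agree on it everywhere. *)
have -> : ('E_P[fun w => g (stopped (partial_sum X) tau w)] =
    'E_P[f \o stopped (partial_sum X) tau])%E.
  congr (expectation P _); apply/funext => w /=; rewrite fE// /stopped.
  by case: (tau w).
have mstopped : measurable_fun setT (stopped (partial_sum X) tau).
  apply: (measurable_fun_countable_cases
    (F := fun t w => if t is Some k then partial_sum X k w else 0)) => //.
  by case=> [k|]//; exact: measurable_sum.
rewrite (integral_stopped_sum meq tauM); last first.
  move=> i i1; rewrite -fXE//; apply: expectation_ge0 => w; exact: f_ge0.
have ZE : ('E_P[Z] = \sum_(1 <= i < M.+1)
    'E_P[(f \o X i) \* \1_[set w | time_ge (tau w) i]])%E.
  rewrite unlock; under eq_integral do rewrite /Z -sumEFin.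
  rewrite ge0_integral_sum//; last first.
    by move=> i w _; rewrite lee_fin mulr_ge0// indicE.
  by move=> i; apply/measurable_EFinP; exact: mZ.
apply: (@le_trans _ _ ('E_P[Z])%E).
  rewrite ZE big_nat_cond [leRHS]big_nat_cond.
  apply: lee_sum => i /andP[/andP[i1 _] _].
  rewrite -fXE//; apply: (expectation_before_stopping X_assoc) => //.
  by rewrite fXE//; exact: gX_int.
apply: expectation_le => //.
- exact: measurable_sum.
- exact: measurableT_comp.
- by move=> w; apply: sumr_ge0 => i _; rewrite mulr_ge0// indicE.
- by move=> w; exact: f_ge0.
- by apply: filterS tauM => w; exact: Z_le.
Qed.
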